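(* If $\sigma:=\ell\cdot\deg_t(v)>(2n-1)\deg_t(f)$, then $L'=W$, where $L'\subseteq\mathbb{F}_p^{\,r}$ is the intersection of the kernels of the matrices $\tilde A_0,\dots,\tilde A_{n-1}$.
   Context: Let $q=p^w$, $K=\mathbb{F}_q(t)$, $\mathcal{O}=\mathbb{F}_q[t]$. Let $f\in\mathbb{F}_q[t][X]$ be separable of $X$-degree $n\ge2$ with leading coefficient $\ell_f$. Let $v\in\mathbb{F}_q[t]$ be irreducible with $v\nmid\ell_f$ and such that the image of $f$ in $k[X]$, $k=\mathbb{F}_q[t]/(v)$, is squarefree. Let $\mathcal{O}_v$ be the $v$-adic completion of $\mathbb{F}_q[t]$. Write $f=\ell_f f_1\cdots f_r$ with $f_i\in\mathcal{O}_v[X]$ monic irreducible, and $f=\ell_f g_1\cdots g_s$ with $g_j\in\mathbb{F}_q(t)[X]$ monic irreducible; $g_j=f_1^{w_{j,1}}\cdots f_r^{w_{j,r}}$ with $w_{j,i}\in\{0,1\}$; $W\subseteq\mathbb{F}_p^{\,r}$ is the $\mathbb{F}_p$-span of the vectors $(w_{j,1},\dots,w_{j,r})^T$. Fix $\ell\ge1$ and $\sigma=\ell\deg_t v$. For $a\in\mathcal{O}_v$, ''$a$ mod $v^\ell$'' is the unique element of $\mathbb{F}_q[t]$ of degree $<\sigma$ congruent to $a$ modulo $v^\ell$ (extended coefficientwise to polynomials). Let $\Phi(f_j)=ff_j'/f_j\in\mathcal{O}_v[X]$ and write $\Phi(f_j)\bmod v^\ell=\sum_{i=0}^{n-1}a_{i,j}X^i$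 with $a_{i,j}\in\mathbb{F}_q[t]$. Put $m=\deg_t(f)+1$ and $\phi_m(\sum_kc_kt^k)=(c_m,\dots,c_{\sigma-1})^T\in\mathbb{F}_q^{\sigma-m}$. Let $A_i$ be the $(\sigma-m)\times r$ matrix over $\mathbb{F}_q$ with columns $\phi_m(a_{i,1}),\dots,\phi_m(a_{i,r})$. Fix an $\mathbb{F}_p$-basis $\gamma_1,\dots,\gamma_w$ of $\mathbb{F}_q$ and let $\psi:\mathbb{F}_q\to\mathbb{F}_p^{\,w}$, $\sum c_l\gamma_l\mapsto(c_1,\dots,c_w)^T$. $\tilde A_i$ is the $w(\sigma-m)\times r$ matrix over $\mathbb{F}_p$ obtained by replacing each entry $c$ of $A_i$ by the column $\psi(c)$. *)

(* Defs.v *)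
From HB Require Import structures.
From mathcomp Require Import all_boot all_order all_algebra all_field.
From mathcomp Require Import boolp.

Set Implicit Arguments.
Unset Strict Implicit.
Unset Printing Implicit Defensive.

Import GRing.Theory.
Local Open Scope ring_scope.

(* The v-adic completion O_v of F[t] (F a field, v of positive degree),     *)
(* realised as the inverse limit  lim_k F[t]/(v^k):  an element is a        *)
(* sequence (a_k)_k of polynomials with a_k = a_{k+1} mod v^k (so a_k is    *)
(* the reduced representative of degree < k deg v).                         *)

Notation "x %:F" := (@FracField.tofrac _ x).

Record Ov (F : fieldType) (v : {poly F}) (hv : (1 < size v)%N) := MkOv {
  ovseq : nat -> {poly F};
  ovseqP : forall k, ovseq k = ovseq k.+1 %% v ^+ k }.

Section OvRing.
Variables (F : fieldType) (v : {poly F}) (hv : (1 < size v)%N).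
Local Notation O := (Ov hv).

HB.instance Definition _ := gen_eqMixin O.
HB.instance Definition _ := gen_choiceMixin O.

Lemma ov_ext (a b : O) : (forall k, ovseq a k = ovseq b k) -> a = b.
Proof.
case: a b => a aP [b bP] /= h.
have e := funext h; subst b; congr MkOv; exact: Prop_irrelevance.
Qed.

Lemma modDml (x y m : {poly F}) : (x %% m + y) %% m = (x + y) %% m.
Proof. by rewrite !modpD modp_id. Qed.
Lemma modDmr (x y m : {poly F}) : (x + y %% m) %% m = (x + y) %% m.
Proof. by rewrite addrC modDml addrC. Qed.
Lemma modMml (x y m : {poly F}) : (x %% m * y) %% m = (x * y) %% m.
Proof. by rewrite mulrC modp_mul mulrC. Qed.
Lemma modMmr (x y m : {poly F}) : (x * (y %% m)) %% m = (x * y) %% m.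
Proof. exact: modp_mul. Qed.

Lemma modK (x : {poly F}) k : (x %% v ^+ k.+1) %% v ^+ k = x %% v ^+ k.
Proof.
rewrite [in RHS](divp_eq x (v ^+ k.+1)) modpD exprS mulrA modp_mull add0r.
done.
Qed.

Lemma ovred (a : O) k : ovseq a k %% v ^+ k = ovseq a k.
Proof. by rewrite [in RHS](ovseqP a k) (ovseqP a k) modp_id. Qed.

Definition ov0 : O := @MkOv F v hv (fun _ => 0) (fun k => esym (mod0p _)).
Definition ov1 : O := @MkOv F v hv (fun k => 1 %% v ^+ k) (fun k => esym (modK 1 k)).

Fact ovadd_subproof (a b : O) k :
  (ovseq a k + ovseq b k) %% v ^+ k =
  ((ovseq a k.+1 + ovseq b k.+1) %% v ^+ k.+1) %% v ^+ k.
Proof. by rewrite modK (ovseqP a k) (ovseqP b k) modDml modDmr. Qed.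
Definition ovadd (a b : O) : O :=
  @MkOv F v hv (fun k => (ovseq a k + ovseq b k) %% v ^+ k) (ovadd_subproof a b).

Fact ovopp_subproof (a : O) k : - ovseq a k = - ovseq a k.+1 %% v ^+ k.
Proof. by rewrite modpN -ovseqP. Qed.
Definition ovopp (a : O) : O := @MkOv F v hv (fun k => - ovseq a k) (ovopp_subproof a).

Fact ovmul_subproof (a b : O) k :
  (ovseq a k * ovseq b k) %% v ^+ k =
  ((ovseq a k.+1 * ovseq b k.+1) %% v ^+ k.+1) %% v ^+ k.
Proof. by rewrite modK (ovseqP a k) (ovseqP b k) modMml modMmr. Qed.
Definition ovmul (a b : O) : O :=
  @MkOv F v hv (fun k => (ovseq a k * ovseq b k) %% v ^+ k) (ovmul_subproof a b).

Fact ovaddA : associative ovadd.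
Proof. by move=> a b c; apply: ov_ext => k /=; rewrite modDml modDmr addrA. Qed.
Fact ovaddC : commutative ovadd.
Proof. by move=> a b; apply: ov_ext => k /=; rewrite addrC. Qed.
Fact ovadd0 : left_id ov0 ovadd.
Proof. by move=> a; apply: ov_ext => k /=; rewrite add0r ovred. Qed.
Fact ovaddN : left_inverse ov0 ovopp ovadd.
Proof. by move=> a; apply: ov_ext => k /=; rewrite addNr mod0p. Qed.

HB.instance Definition _ := GRing.isZmodule.Build O ovaddA ovaddC ovadd0 ovaddN.

Fact ovmulA : associative ovmul.
Proof. by move=> a b c; apply: ov_ext => k /=; rewrite modMml modMmr mulrA. Qed.
Fact ovmulC : commutative ovmul.
Proof. by move=> a b; apply: ov_ext => k /=; rewrite mulrC. Qed.
Fact ovmul1 : left_id ov1 ovmul.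
Proof. by move=> a; apply: ov_ext => k /=; rewrite modMml mul1r ovred. Qed.
Fact ovmulDl : left_distributive ovmul ovadd.
Proof.
move=> a b c; apply: ov_ext => k /=.
by rewrite modMml mulrDl modDml modDmr.
Qed.
Fact ov1_neq0 : ov1 != ov0.
Proof.
apply/eqP => /(congr1 (fun a => ovseq a 1)) /=.
rewrite expr1 modp_small ?size_poly1 //.
by move/eqP; rewrite oner_eq0.
Qed.

HB.instance Definition _ :=
  GRing.Zmodule_isComNzRing.Build O ovmulA ovmulC ovmul1 ovmulDl ov1_neq0.

Definition toOv (a : {poly F}) : O :=
  @MkOv F v hv (fun k => a %% v ^+ k) (fun k => esym (modK a k)).

Definition ov_mod (a : O) (l : nat) : {poly F} := ovseq a l.

(* a \in O_v equals the element x of K = F(t) (inside K_v): x = n/d with   *)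
(* v not dividing d and a*d = n in O_v.                                     *)
Definition ov_rep (a : O) (x : {fraction {poly F}}) : Prop :=
  exists n d : {poly F},
    [/\ ~~ (v %| d), x = n%:F / d%:F &
        forall k, (ovseq a k * d) %% v ^+ k = n %% v ^+ k].

End OvRing.

Definition ring_irreducible (R : comNzRingType) (x : R) : Prop :=
  ~ (exists y, x * y = 1) /\
  forall a b, x = a * b -> (exists y, a * y = 1) \/ (exists y, b * y = 1).

Definition sqfree_poly (R : comNzRingType) (p : {poly R}) : Prop :=
  forall g h : {poly R}, p = g ^+ 2 * h -> exists y, g * y = 1.

(* monic generator of (v); the residue field k = F[t]/(v) is {poly %/ monicv v} *)
Definition monicv (F : fieldType) (v : {poly F}) : {poly F} := (lead_coef v)^-1 *: v.

Definition degt (F : fieldType) (f : {poly {poly F}}) : nat :=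
  (\max_(i < size f) (size (f`_i)%R).-1)%N.

(* Phi(f_j) = f f_j' / f_j = l_f (prod_{i <> j} f_i) f_j' *)
Definition Phi (R : comNzRingType) (lf : R) (r : nat) (fs : 'I_r -> {poly R})
  (j : 'I_r) : {poly R} :=
  lf *: (\prod_(i < r | i != j) fs i) * (fs j)^`().

Definition phim (F : fieldType) (m sigma : nat) (c : {poly F}) : 'cV[F]_(sigma - m) :=
  \col_(k < sigma - m) c`_(m + k).

Definition Fp_emb (F : fieldType) (p : nat) (c : 'F_p) : F := (c : nat)%:R.

Definition gam_comb (F : fieldType) (p w : nat) (gam : 'I_w -> F)
  (c : 'cV['F_p]_w) : F := \sum_(l < w) Fp_emb F (c l 0) * gam l.

Definition Amat (F : fieldType) (v : {poly F}) (hv : (1 < size v)%N)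
  (lf : Ov hv) (r : nat) (fs : 'I_r -> {poly Ov hv}) (l m sigma : nat) (i : nat)
  : 'M[F]_(sigma - m, r) :=
  \matrix_(k < sigma - m, j < r) phim m sigma (ov_mod (Phi lf fs j)`_i l) k 0.

(* tilde A_i over F_p: each entry c replaced by the column psi(c) *)
Definition Atil (F : fieldType) (p w : nat) (psi : F -> 'cV['F_p]_w)
  (a r : nat) (A : 'M[F]_(a, r)) : 'M['F_p]_(a * w, r) :=
  \matrix_(t < a * w, j < r) mxvec (\matrix_(k < a, l0 < w) psi (A k j) l0 0) 0 t.

Definition Wmx (p s r : nat) (wm : 'I_s -> 'I_r -> bool) : 'M['F_p]_(s, r) :=
  \matrix_(j < s, i < r) (wm j i)%:R.

(* Main.v *)
Require Import Defs.
From HB Require Import structures.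
From mathcomp Require Import all_boot all_order all_algebra all_field.
From mathcomp Require Import perm boolp generic_quotient zify.

Set Implicit Arguments.
Unset Strict Implicit.
Unset Printing Implicit Defensive.
Import GRing.Theory.
Local Open Scope ring_scope.

(** Let x be in the common kernel and h the reduction mod v^l of the sum of the
    x_m Phi(f_m), so that deg_t h <= deg_t f. Since Phi(f_m) = 0 mod f_i for
    m <> i and the Phi(f_m) sum to f', the polynomial h - x_i f' lies in
    (f_i, v^l). If f_i divides the factor g_j, with primitive integral form G,
    then Res(G, h - x_i f') also lies in (f_i, v^l), so v^l divides it; its
    t-degree is at most (2n - 1) deg_t f < sigma, so it is 0 and G divides
    h - x_i f' over F_q(t). Reducing this divisibility mod v, any other f_k
    dividing g_j divides (x_k - x_i) Phi(f_k) mod v, and as f is squarefree mod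
    v over a perfect field this forces x_k = x_i. Hence x is constant on the
    blocks of the partition of the f_i defined by the g_j. Conversely, if
    f = G C, the sum of the Phi(f_i) over the block of g_j is C G', which has
    t-degree at most deg_t f. *)

(** * Squarefree polynomials over a finite field *)

Lemma deriv_prod (R : comNzRingType) (I : finType) (P : pred I) (f : I -> {poly R}) :
  (\prod_(i | P i) f i)^`() =
  \sum_(i | P i) (\prod_(j | P j && (j != i)) f j) * (f i)^`().
Proof.
(* Induction over a duplicate-free list, so that the condition [j != i] removes exactly one
   factor. *)
have seqE (s : seq I) : uniq s -> (\prod_(i <- s) f i)^`() =
    \sum_(i <- s) (\prod_(j <- s | j != i) f j) * (f i)^`().
  elim: s => [|a s IH] /=; first by rewrite !big_nil -[1]/(1%:P) derivC.
  case/andP=> as_ us; rewrite !big_cons eqxx /= derivM IH // mulrC mulr_sumr.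
  congr (_ * _ + _).
    rewrite big_seq [in RHS]big_seq_cond; apply: eq_bigl => i.
    by have [is_|//] := boolP (i \in s); case: eqVneq is_ as_ => [->->|].
  rewrite big_seq [in RHS]big_seq; apply: eq_bigr => i si.
  rewrite big_cons; case: eqVneq as_ si => [->|_ _ _]; last by rewrite mulrA.
  by move/negPf->.
rewrite -big_filter seqE ?filter_uniq ?index_enum_uniq // big_filter.
by apply: eq_bigr => i _; rewrite big_filter_cond.
Qed.

Section FiniteField.

Variable k : finFieldType.

(** Only exponents divisible by the characteristic occur in [q], and each coefficient has a p-th
    root because Frobenius is bijective on a finite field. *)
Lemma deriv0_pexp (q : {poly k}) : q^`() = 0 ->
  exists2 p : nat, prime p & exists b : {poly k}, q = b ^+ p.
Proof.
move=> q'0; have [p p_pr pk] := finPcharP k.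
exists p => //.
have [rt _ rtK] := injF_bij (fmorph_inj (pFrobenius_aut pk)).
have coef0 i : ~~ (p %| i)%N -> q`_i = 0.
  case: i => [|i] pi; first by rewrite dvdn0 in pi.
  have /(congr1 (fun u : {poly k} => u`_i)) := q'0.
  rewrite coef_deriv coef0 -mulr_natr => /eqP.
  by rewrite mulf_eq0 -(dvdn_pcharf pk) (negPf pi) orbF => /eqP.
pose b := \poly_(i < size q) rt q`_(p * i); exists b.
have pP : p \in [pchar {poly k}] by rewrite pchar_poly.
have -> : b ^+ p = \sum_(i < size q) q`_(p * i) *: 'X^(p * i).
  rewrite /b poly_def -(pFrobenius_autE pP) rmorph_sum; apply: eq_bigr => i _.
  rewrite /= pFrobenius_autE exprZn -exprM mulnC; congr (_ *: _).
  by rewrite -[LHS](pFrobenius_autE pk) rtK.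
have p0 := prime_gt0 p_pr.
apply/polyP=> i; rewrite coef_sum.
have [/dvdnP[e ->]|pi] := boolP (p %| i)%N; last first.
  rewrite coef0 // big1 // => j _; rewrite coefZ coefXn.
  by case: eqP pi => [->|]; rewrite ?dvdn_mulr ?mulr0.
rewrite mulnC; have [eq_|eq_] := ltnP e (size q).
  rewrite (bigD1 (Ordinal eq_)) //= big1 => [|j jne].
    by rewrite addr0 coefZ coefXn eqxx mulr1.
  rewrite coefZ coefXn eqn_pmul2l // (_ : (e == j) = false) ?mulr0 //.
  by apply: contraNF jne => /eqP ej; apply/eqP/val_inj.
rewrite nth_default ?(leq_trans eq_) ?leq_pmull // big1 // => j _.
rewrite coefZ coefXn eqn_pmul2l // (_ : (e == j) = false) ?mulr0 //.
by apply: contraTF eq_ => /eqP->; rewrite -ltnNge ltn_ord.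
Qed.

Lemma sqfree_size (P d : {poly k}) : sqfree_poly P -> d ^+ 2 %| P -> size d = 1.
Proof.
move=> sqP /dvdpP[h Ph].
have [y dy] : exists y, d * y = 1 by apply: (sqP d h); rewrite mulrC.
by apply/eqP; rewrite -dvdp1 -dy dvdp_mulr.
Qed.

Section Squarefree.

Variables (r : nat) (c : k) (f : 'I_r -> {poly k}).
Hypothesis sqf : sqfree_poly (c *: \prod_i f i).

Lemma dvd_scale_prod (P : pred 'I_r) (d : {poly k}) :
  d %| \prod_(i | P i) f i -> d %| c *: \prod_i f i.
Proof.
move=> dP; have [->|c0] := eqVneq c 0; first by rewrite scale0r dvdp0.
by rewrite dvdpZr // (bigID P) dvdp_mulr.
Qed.

(** The square of the gcd divides [f i * f j], hence the squarefree product. *)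
Lemma sqfree_coprime i j : i != j -> coprimep (f i) (f j).
Proof.
move=> ij; rewrite /coprimep (sqfree_size sqf) //.
apply: (@dvd_scale_prod (fun m => (m == i) || (m == j))).
rewrite (bigD1 i) ?eqxx //= (bigD1 j) /=; last by rewrite eqxx orbT eq_sym.
by rewrite mulrA dvdp_mulr // expr2 dvdp_mul ?dvdp_gcdl ?dvdp_gcdr.
Qed.

Lemma sqfree_coprime_prod (P : pred 'I_r) i : ~~ P i ->
  coprimep (f i) (\prod_(j | P j) f j).
Proof.
move=> nPi; elim/big_rec: _ => [|j q Pj IH]; first exact: coprimep1.
rewrite coprimepMr IH andbT sqfree_coprime //.
by apply: contraNneq nPi => ->.
Qed.

Lemma sqfree_deriv_neq0 i : (1 < size (f i))%N -> (f i)^`() != 0.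
Proof.
move=> fi; apply/eqP => /deriv0_pexp[p /prime_gt1 p1 [b fb]].
have sb : size b = 1.
  apply: (sqfree_size sqf); apply: (@dvd_scale_prod (pred1 i)).
  by rewrite big_pred1_eq fb dvdp_exp2l.
move: fi; rewrite fb; have /eqP/size_poly1P[a _ ->] := sb.
by rewrite -polyC_exp ltnNge size_polyC_leq1.
Qed.

(** The other factors are coprime to [f i], and its derivative is nonzero of smaller degree. This
    will say that Phi(f_i) does not vanish modulo f_i over the residue field. *)
Lemma sqfree_ndvd_deriv i : (1 < size (f i))%N ->
  ~~ (f i %| (\prod_(j | j != i) f j) * (f i)^`()).
Proof.
move=> fi; rewrite Gauss_dvdpr ?sqfree_coprime_prod ?eqxx //.
apply/negP => /(dvdp_leq (sqfree_deriv_neq0 fi)).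
by rewrite leqNgt lt_size_deriv // -size_poly_eq0 -lt0n (ltn_trans _ fi).
Qed.

End Squarefree.

End FiniteField.

(** * Quotients of F[t] by a monic polynomial *)

Section Quotient.

Variables (F : fieldType) (h : {poly F}).
Hypotheses (h_monic : h \is monic) (h_size : (1 < size h)%N).

Lemma in_qpoly_eq0 a : (in_qpoly h a == 0) = (h %| a).
Proof.
have mk : mk_monic h = h by rewrite /mk_monic h_size h_monic.
by rewrite -val_eqE /= mk -[Pdiv.Ring.rmodp _ _]/(_) -Pdiv.IdomainMonic.modpE.
Qed.

End Quotient.

(** * Gauss's lemma *)

Section Irreducible.

Variable F : fieldType.

Lemma irreducible_factor (a : {poly F}) : (1 < size a)%N ->
  exists2 q, irreducible_poly q & q %| a.
Proof.
have [n] := ubnP (size a); elim: n => // n IH in a *; rewrite ltnS => an a1.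
have [[q [q1 qa nqa]]|nq] :=
    pselect (exists q : {poly F}, [/\ size q != 1%N, q %| a & ~~ (q %= a)]); last first.
  exists a => //; split => // q q1 qa.
  by case: (boolP (q %= a)) => // nqa; case: nq; exists q; split.
have a0 : a != 0 by rewrite -size_poly_gt0 ltnW.
have sqa : (size q < size a)%N.
  by rewrite ltn_neqAle (dvdp_leq a0 qa) (dvdp_size_eqp qa) nqa.
have q2 : (1 < size q)%N.
  by rewrite ltn_neqAle eq_sym q1 size_poly_gt0 (dvdpN0 qa a0).
have [|q' iq' q'q] := IH q _ q2; first exact: leq_trans an.
by exists q' => //; apply: dvdp_trans qa.
Qed.

Section Monic.

Variable v : {poly F}.
Hypothesis v_size : (1 < size v)%N.

Let v_neq0 : v != 0.
Proof. by rewrite -size_poly_gt0 ltnW. Qed.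

Let v0 : lead_coef v != 0.
Proof. by rewrite lead_coef_eq0. Qed.

Lemma monicv_monic : monicv v \is monic.
Proof. by rewrite monicE lead_coefZ mulVf. Qed.

Lemma size_monicv : size (monicv v) = size v.
Proof. by rewrite size_scale // invr_neq0. Qed.

Lemma monicv_eqp : monicv v %= v.
Proof. by rewrite eqp_scale // invr_neq0. Qed.

Lemma monicv_exp_monic k : monicv v ^+ k \is monic.
Proof. exact: monic_exp monicv_monic. Qed.

Lemma size_exp_modulus k : size (v ^+ k) = (k * (size v).-1).+1.
Proof. by rewrite polySpred ?expf_neq0 // size_exp mulnC. Qed.

Lemma monicv_exp_eqp k : monicv v ^+ k %= v ^+ k.
Proof. by rewrite eqp_exp ?monicv_eqp. Qed.

Lemma size_monicv_exp k : (0 < k)%N -> (1 < size (monicv v ^+ k))%N.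
Proof.
move=> k0; rewrite (eqp_size (monicv_exp_eqp k)) size_exp_modulus ltnS muln_gt0.
by rewrite k0; case: size v_size => [|[]].
Qed.

Lemma monicv_irreducible : irreducible_poly v -> monic_irreducible_poly (monicv v).
Proof.
move=> hv; split; last exact: monicv_monic; split; first by rewrite size_monicv.
move=> q q1; rewrite (eqp_dvdr _ monicv_eqp) (eqp_rtrans monicv_eqp).
exact: hv.2.
Qed.

Lemma in_qpoly_monicv_eq0 k a : (0 < k)%N ->
  (in_qpoly (monicv v ^+ k) a == 0) = (v ^+ k %| a).
Proof.
move=> k0; rewrite in_qpoly_eq0 ?monicv_exp_monic ?size_monicv_exp //.
exact: eqp_dvdl (monicv_exp_eqp k).
Qed.

Lemma in_qpoly_monicv_mod k a : (0 < k)%N ->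
  in_qpoly (monicv v ^+ k) (a %% v ^+ k) = in_qpoly (monicv v ^+ k) a.
Proof.
move=> k0; apply/eqP; rewrite -subr_eq0 -rmorphB in_qpoly_monicv_eq0 //.
by rewrite /dvdp modpD modpN modp_id subrr.
Qed.

End Monic.

Lemma content_div (q : {poly F}) (G : {poly {poly F}}) :
  (forall i, q %| G`_i) -> exists G', G = q *: G'.
Proof.
move=> qG; exists (map_poly (fun a => a %/ q) G); apply/polyP => i.
by rewrite coefZ coef_map_id0 ?div0p // mulrC divpK.
Qed.

(* Irreducible factors of a are removed one at a time: each of them is prime,
   hence divides the content of G or that of C. *)
Lemma gauss_clear (f G C : {poly {poly F}}) (a : {poly F}) : a != 0 ->
  a *: f = G * C ->
  exists G' C' b, [/\ f = G' * C', b != 0 & G = b *: G'].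
Proof.
have [n] := ubnP (size a); elim: n => // n IH in a G C *; rewrite ltnS => an a0.
have [a1|a1] := leqP (size a) 1.
  move: a0 an; rewrite (size1_polyC a1) polyC_eq0 => c0 _ fGC.
  (* A constant [a] is a unit of F[t], absorbed by the cofactor. *)
  exists G, ((a`_0)^-1%:P *: C), 1; rewrite oner_neq0 scale1r; split=> //.
  by rewrite -scalerAr -fGC scalerA -polyCM mulVf // scale1r.
have [q iq /dvdpP[b ab]] := irreducible_factor a1.
have qa0 : q != 0 by apply: irredp_neq0.
have b0 : b != 0 by apply: contraNneq a0 => b0; rewrite ab b0 mul0r.
have sb : (size b < n)%N.
  apply: leq_trans an; rewrite ab size_mul //.
  by have [q1 _] := iq; rewrite -subn1 ltn_subRL addnC ltn_add2l.
pose k := {poly %/ monicv q with monicv_irreducible iq.1 iq}.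
pose red : {rmorphism {poly F} -> k} := in_qpoly (monicv q).
have red0 x : (red x == 0) = (q %| x).
  exact: (in_qpoly_monicv_eq0 iq.1 (k := 1)).
have redP (u : {poly {poly F}}) : map_poly red u = 0 -> exists u', u = q *: u'.
  move=> u0; apply: content_div => i; rewrite -red0 -coef_map u0 coef0 //.
move=> fGC; have /eqP : map_poly red G * map_poly red C = 0.
  rewrite -rmorphM -fGC; apply/polyP => i; rewrite coef_map coefZ coef0.
  by apply/eqP; rewrite red0 ab -mulrA mulrCA dvdp_mulr.
have cancel_q (x y : {poly {poly F}}) : q *: x = q *: y -> x = y.
  by rewrite -!mul_polyC => /mulfI; apply; rewrite polyC_eq0.
rewrite mulf_eq0 => /orP[/eqP/redP[G1 eG]|/eqP/redP[C1 eC]].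
  have [|G' [C' [d [-> d0 eG1]]]] := IH b G1 C sb b0.
    by apply: cancel_q; rewrite scalerA mulrC -ab fGC eG scalerAl.
  by exists G', C', (q * d); rewrite mulf_neq0 // eG eG1 scalerA.
by apply: (IH b G C1 sb b0); apply: cancel_q;
  rewrite scalerA mulrC -ab fGC eC scalerAr.
Qed.

End Irreducible.

Section Fractions.

Variable R : idomainType.

Local Notation tofrac := (@FracField.tofrac R).

Lemma tofrac_inj : injective tofrac.
Proof. by move=> x y /eqP; rewrite tofrac_eq => /eqP. Qed.

Lemma map_tofrac_inj : injective (map_poly tofrac).
Proof. exact: map_inj_poly tofrac_inj (tofrac0 _). Qed.

Lemma frac_denominator (x : {fraction R}) :
  exists n d : R, d != 0 /\ x = tofrac n / tofrac d.
Proof.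
elim/quotW: x => x; exists (\n_x), (\d_x); rewrite denom_ratioP; split=> //.
apply: (canRL (mulfK _)); first by rewrite tofrac_eq0 denom_ratioP.
unlock FracField.tofrac; rewrite -[LHS]FracField.pi_mul; apply/eqmodP.
rewrite /= FracField.equivfE /FracField.mulf.
rewrite !numden_Ratio ?mulf_neq0 ?oner_neq0 ?denom_ratioP //.
by rewrite !mulr1 mulrC.
Qed.

Lemma clear_denominators (g : {poly {fraction R}}) :
  exists G d, d != 0 /\ map_poly tofrac G = tofrac d *: g.
Proof.
elim/poly_ind: g => [|g c [G [d [d0 eG]]]].
  by exists 0, 1; rewrite oner_neq0 rmorph0 scaler0.
have [n [e [e0 ->]]] := frac_denominator c.
exists (e *: G * 'X + (d * n)%:P), (e * d); rewrite mulf_neq0 //; split=> //.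
rewrite rmorphD rmorphM /= map_polyX map_polyC /= -mul_polyC rmorphM /= map_polyC /=.
rewrite mul_polyC eG scalerDr -!scalerAl scalerA -rmorphM; congr (_ + _).
rewrite scale_polyC; congr _%:P; rewrite !rmorphM [RHS]mulrAC [RHS]mulrC [RHS]mulrA /=.
by rewrite -[in RHS]mulrA; congr (_ * _); rewrite mulrCA mulfV ?mulr1 // tofrac_eq0.
Qed.

End Fractions.

(** * Degree bounds and the resultant *)

Section Bivariate.

Variable F : fieldType.
Implicit Types f G C H : {poly {poly F}}.

(** Clearing denominators gives a factorisation of a multiple of [f], from which [gauss_clear]
    removes the multiplier. The factor obtained is a scalar multiple of the monic [g], so the scalar
    is its leading coefficient. *)
Lemma integral_factor f (g h : {poly {fraction {poly F}}}) :
  f != 0 -> g \is monic -> map_poly (@FracField.tofrac _) f = g * h ->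
  exists G C, f = G * C /\
    map_poly (@FracField.tofrac _) G = (lead_coef G)%:F *: g.
Proof.
move=> f0 g_monic fgh.
have [G [d [d0 eG]]] := clear_denominators g.
have [C [e [e0 eC]]] := clear_denominators h.
have fGC : (d * e) *: f = G * C.
  apply: map_tofrac_inj; rewrite -mul_polyC [LHS]rmorphM [RHS]rmorphM /= map_polyC /=.
  rewrite eG eC fgh tofracM mul_polyC.
  by rewrite -scalerAr -scalerAl scalerA mulrC.
have [G' [C' [b [-> b0 eG']]]] := gauss_clear (mulf_neq0 d0 e0) fGC.
exists G', C'; split=> //.
have {}eG' : map_poly (@FracField.tofrac _) G' = ((d%:F / b%:F) *: g).
  apply: (@scalerI _ _ b%:F); first by rewrite tofrac_eq0.
  rewrite scalerA mulrC divfK ?tofrac_eq0 // -eG eG' -[in RHS]mul_polyC.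
  by rewrite rmorphM /= map_polyC mul_polyC.
have := lead_coef_map_inj (@tofrac_inj _) (tofrac0 _) G'.
by rewrite eG' lead_coefZ (monicP g_monic) mulr1 => ->.
Qed.

Lemma sizeY_mul G C : G != 0 -> C != 0 ->
  sizeY (G * C) = (sizeY G + sizeY C).-1.
Proof. by move=> G0 C0; rewrite !sizeYE rmorphM size_mul ?swapXY_eq0. Qed.

Lemma sizeY_degt f : f != 0 -> sizeY f = (degt f).+1.
Proof.
move=> f0; apply/eqP; rewrite eqn_leq; apply/andP; split.
  apply/bigmax_leqP => i _; apply: (leq_trans (leqSpred _)).
  by rewrite ltnS (bigmax_sup i).
have : (0 < sizeY f)%N by rewrite lt0n sizeY_eq0.
case: (sizeY f) (max_size_coefXY f) => // d fd _; rewrite ltnS.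
apply/bigmax_leqP => i _; have := fd i.
by case: (size f`_i).
Qed.

Lemma size_prod_bound (I : finType) (a : I -> {poly F}) (d : I -> nat) :
  (forall i, size (a i) <= (d i).+1)%N -> (size (\prod_i a i)%R <= (\sum_i d i).+1)%N.
Proof.
move=> ad; elim/big_rec2: _ => [|i n p _ IH]; first by rewrite size_poly1.
apply: leq_trans (size_polyMleq _ _) _.
by have := leq_add (ad i) IH; rewrite addSn addnS; case: (_ + _)%N.
Qed.

Lemma size_resultant G H dG dH :
  (forall i, size (G`_i)%R <= dG.+1)%N -> (forall i, size (H`_i)%R <= dH.+1)%N ->
  (size (resultant G H) <= ((size H).-1 * dG + (size G).-1 * dH).+1)%N.
Proof.
move=> Gd Hd; apply: leq_trans (size_sum _ _ _) _; apply/bigmax_leqP => s _.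
rewrite -[(-1) ^+ _]/(_) mulr_sign (fun_if (fun u : {poly F} => size u)).
rewrite size_polyN if_same.
(* Degree bound for row [i] of the Sylvester matrix: its first [(size H).-1] rows hold coefficients
   of [G], the others those of [H]. *)
pose d (i : 'I_((size H).-1 + (size G).-1)) := if split i is inl _ then dG else dH.
have dl i : d (lshift _ i) = dG by rewrite /d (unsplitK (inl _ i)).
have dr i : d (rshift _ i) = dH by rewrite /d (unsplitK (inr _ i)).
have <- : (\sum_i d i = (size H).-1 * dG + (size G).-1 * dH)%N.
  rewrite big_split_ord (eq_bigr _ (fun i _ => dl i))
    (eq_bigr _ (fun i _ => dr i)).
  by rewrite !sum_nat_const !card_ord.
apply: size_prod_bound => i.
rewrite Sylvester_mxE /d.
by case: (split i) => k; case: (_ <= s i)%N; rewrite ?mulr1n ?mulr0n ?size_poly0 ?Gd ?Hd.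
Qed.

End Bivariate.

(** * Common factors detected modulo a power of [v] *)

Section ReductionModPowers.

Variables (F : fieldType) (v : {poly F}) (v_size : (1 < size v)%N).

(** Multiplication by a monic polynomial adds degrees even when the coefficient ring has zero
    divisors, as the quotient by a power of [v] may. *)
Lemma monic_dvd_const (R : comNzRingType) (q A : {poly R}) (c : R) :
  q \is monic -> (1 < size q)%N -> c%:P = A * q -> c = 0.
Proof.
move=> q_monic q1 cAq; apply/eqP; rewrite -polyC_eq0 cAq.
have [->|A0] := eqVneq A 0; first by rewrite mul0r.
have := size_polyC_leq1 c; rewrite cAq size_Mmonic // leqNgt => /negP[].
have : (0 < size A)%N by rewrite size_poly_gt0.
by case: (size A) => // a _; case: (size q) q1 => [|[|b]] // _; rewrite !addnS addSn.
Qed.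

(* The resultant lies in the ideal (G, H), hence modulo v ^ l it is a constant
   multiple of q, hence 0; its degree then forces it to vanish. *)
Lemma common_factor l (G H : {poly {poly F}}) dG dH
    (q A B : {poly {poly %/ monicv v ^+ l}}) :
  (0 < l)%N -> q \is monic -> (1 < size q)%N ->
  map_poly (in_qpoly (monicv v ^+ l)) G = A * q ->
  map_poly (in_qpoly (monicv v ^+ l)) H = B * q ->
  (forall i, size (G`_i)%R <= dG.+1)%N -> (forall i, size (H`_i)%R <= dH.+1)%N ->
  ((size H).-1 * dG + (size G).-1 * dH < l * (size v).-1)%N ->
  (dH < l * (size v).-1)%N ->
  (1 < size G)%N ->
  H = 0 \/ (1 < size (gcdp G H))%N.
Proof.
move=> l0 q_monic q1 GA HB Gd Hd bound dHl G1.
have small (a : {poly F}) : in_qpoly (monicv v ^+ l) a = 0 ->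
    (size a <= l * (size v).-1)%N -> a = 0.
  move/eqP; rewrite in_qpoly_monicv_eq0 // => va sa.
  apply: contraTeq sa => a0; rewrite -ltnNge -(size_exp_modulus v_size).
  exact: dvdp_leq.
(* If [H] is constant in X, it plays the part of the resultant itself: its reduction is a constant
   multiple of [q]. *)
have [H1|H1] := leqP (size H) 1.
  left; move: HB; rewrite (size1_polyC H1) map_polyC => HB.
  rewrite (small H`_0) //; last exact: leq_trans (Hd 0%N) _.
  exact: monic_dvd_const HB.
right; rewrite -resultant_eq0; apply/eqP/small; last first.
  exact: leq_trans (size_resultant Gd Hd) _.
have [[x y] _ /= xy] := resultant_in_ideal G1 H1.
apply: (@monic_dvd_const _ q (map_poly (in_qpoly _) x * A +
  map_poly (in_qpoly _) y * B)) => //.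
by rewrite -map_polyC /= xy rmorphD !rmorphM /= GA HB mulrDl !mulrA.
Qed.

End ReductionModPowers.

Lemma integral_irreducible (R : idomainType) (G : {poly R}) (a : {fraction R})
    (g : {poly {fraction R}}) : irreducible_poly g ->
  map_poly (@FracField.tofrac _) G = a *: g -> G != 0 -> irreducible_poly G.
Proof.
move=> ig eG G0.
have szE (p : {poly R}) : size (map_poly (@FracField.tofrac R) p) = size p.
  exact/size_map_inj_poly/tofrac0/tofrac_inj.
have a0 : a != 0.
  apply: contraNneq G0 => a0; apply/eqP/map_tofrac_inj.
  by rewrite eG a0 scale0r rmorph0.
have sG : size G = size g by rewrite -szE eG size_scale.
split; first by rewrite sG ig.1.
move=> q q1 qG; rewrite -dvdp_size_eqp // -szE sG; apply/eqP/eqp_size/ig.2.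
  by rewrite szE.
(* Over a domain, divisibility means pseudo-divisibility: some nonzero [c] makes [c *: G] a multiple
   of [q]. The scalar [c] becomes invertible in the fraction field. *)
have /Pdiv.Idomain.dvdpP[[c u] /= c0 cG] := qG.
apply/dvdpP; exists ((c%:F * a)^-1 *: map_poly (@FracField.tofrac _) u).
rewrite -scalerAl -rmorphM -cG -mul_polyC rmorphM /= map_polyC mul_polyC eG.
by rewrite !scalerA -mulrA mulVf ?scale1r // mulf_neq0 // tofrac_eq0.
Qed.

(** * Coordinates over the prime field *)

Section PrimeField.

Variables (F : fieldType) (p : nat).
Hypothesis hchar : p \in [pchar F].

Let p_pr : prime p := pcharf_prime hchar.

Let natr_modFp n : (n %% (Zp_trunc (pdiv p)).+2)%:R = n%:R :> F.
Proof. by rewrite Fp_cast // (GRing.natr_mod_pchar hchar). Qed.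

Lemma Fp_embD (a b : 'F_p) : Fp_emb F (a + b) = Fp_emb F a + Fp_emb F b.
Proof. by rewrite /Fp_emb /= natr_modFp natrD. Qed.

Lemma Fp_embM (a b : 'F_p) : Fp_emb F (a * b) = Fp_emb F a * Fp_emb F b.
Proof. by rewrite /Fp_emb /= natr_modFp natrM. Qed.

Lemma Fp_emb_sum (I : finType) (a : I -> 'F_p) :
  Fp_emb F (\sum_i a i) = \sum_i Fp_emb F (a i).
Proof. exact: (big_morph _ Fp_embD (erefl : Fp_emb F (0 : 'F_p) = 0)). Qed.

Lemma Fp_emb_bool (b : bool) : Fp_emb F (b%:R : 'F_p) = b%:R.
Proof. by case: b; rewrite /Fp_emb //= modn_small. Qed.

Lemma Fp_emb_eq0 (a : 'F_p) : Fp_emb F a = 0 -> a = 0.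
Proof.
move/eqP; rewrite -(dvdn_pcharf hchar) => pa; apply/val_inj/eqP => /=.
apply: contraTT pa => a0; rewrite gtnNdvd ?lt0n //.
by have := ltn_ord a; rewrite {2}Fp_cast.
Qed.

Lemma Fp_emb_inj : injective (@Fp_emb F p).
Proof.
move=> a b ab; apply/eqP; rewrite -subr_eq0; apply/eqP/Fp_emb_eq0.
apply: (addIr (Fp_emb F b)); rewrite -Fp_embD subrK add0r; exact: ab.
Qed.

Variables (w : nat) (gam : 'I_w -> F) (psi : F -> 'cV['F_p]_w).
Hypotheses (hpsi1 : forall c, gam_comb gam (psi c) = c)
           (hpsi2 : forall x, psi (gam_comb gam x) = x).

(** The linearity of [psi] over the prime field is inherited from its inverse [gam_comb]. *)
Lemma psi_comb (I : finType) (c : I -> F) (x : I -> 'F_p) :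
  \sum_i x i *: psi (c i) = psi (\sum_i c i * Fp_emb F (x i)).
Proof.
rewrite -[LHS]hpsi2; congr psi; rewrite /gam_comb.
under eq_bigr => l _ do rewrite summxE Fp_emb_sum mulr_suml.
rewrite exchange_big; apply: eq_bigr => i _ /=.
rewrite -[in RHS](hpsi1 (c i)) mulrC mulr_sumr; apply: eq_bigr => l _.
by rewrite mxE Fp_embM mulrA.
Qed.

Lemma psi_eq0 c : psi c = 0 <-> c = 0.
Proof.
have psi0 : psi 0 = 0.
  rewrite -[RHS]hpsi2 /gam_comb big1 // => l _.
  by rewrite mxE /Fp_emb mul0r.
by split=> [|->//]; rewrite -psi0 => /(congr1 (gam_comb gam)); rewrite !hpsi1.
Qed.

Lemma Atil_mulmx_eq0 a r (A : 'M[F]_(a, r)) (x : 'cV['F_p]_r) :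
  Atil psi A *m x = 0 <-> forall k, \sum_j A k j * Fp_emb F (x j 0) = 0.
Proof.
have AtilE k l0 : (Atil psi A *m x) (mxvec_index k l0) 0 =
    psi (\sum_j A k j * Fp_emb F (x j 0)) l0 0.
  rewrite -psi_comb mxE summxE; apply: eq_bigr => j _.
  by rewrite !mxE mxvecE !mxE mulrC.
split=> [A0 k | A0].
  by apply/psi_eq0/colP => l0; rewrite -AtilE A0 !mxE.
apply/colP => t; case/mxvec_indexP: t => k l0.
by rewrite AtilE A0 (psi_eq0 0).2 // !mxE.
Qed.

End PrimeField.

(** * The v-adic completion *)

Section Completion.

Variables (F : fieldType) (v : {poly F}) (hv : (1 < size v)%N).
Local Notation O := (Ov hv).

Fact toOv_is_zmod_morphism : zmod_morphism (toOv hv).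
Proof. by move=> a b; apply: ov_ext => k /=; rewrite !modpD !modpN !modp_id. Qed.

Fact toOv_is_monoid_morphism : monoid_morphism (toOv hv).
Proof. by split=> [|a b]; apply: ov_ext => k //=; rewrite modMml modMmr. Qed.

HB.instance Definition _ :=
  GRing.isZmodMorphism.Build {poly F} O (toOv hv) toOv_is_zmod_morphism.
HB.instance Definition _ :=
  GRing.isMonoidMorphism.Build {poly F} O (toOv hv) toOv_is_monoid_morphism.

Lemma ovseq_mod (a : O) k l : (k <= l)%N -> ovseq a l %% v ^+ k = ovseq a k.
Proof.
move=> kl; rewrite -(subnKC kl); elim: (l - k)%N => [|n IH].
  by rewrite addn0 ovred.
rewrite -IH addnS (divp_eq (ovseq a (k + n).+1) (v ^+ (k + n))) -ovseqP modpD.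
by rewrite exprD mulrA mulrAC modp_mull add0r.
Qed.

(** Scaling by a constant of F keeps a representative reduced. Together with [ovseq_sum], this makes
    truncation F-linear. *)
Lemma ovseqZ (c : F) (a : O) l : ovseq (toOv hv c%:P * a) l = c *: ovseq a l.
Proof. by rewrite /= modMml mul_polyC modpZl ovred. Qed.

Lemma ovseq_sum (I : finType) (a : I -> O) l :
  ovseq (\sum_i a i) l = \sum_i ovseq (a i) l.
Proof.
apply: (big_morph (fun a : O => ovseq a l)) => // x y.
by rewrite /= modpD !ovred.
Qed.

Lemma size_ovseq (a : O) l : (size (ovseq a l) <= l * (size v).-1)%N.
Proof.
rewrite -ltnS -(size_exp_modulus hv) -(ovred a) ltn_modp expf_neq0 //.
by rewrite -size_poly_gt0 ltnW.
Qed.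

(* {poly %/ h} is the quotient by h only for h monic of positive degree (else it
   is the quotient by 'X), hence monicv and the exponent k.+1. *)
Definition ovred_qpoly k (a : O) : {poly %/ monicv v ^+ k.+1} :=
  in_qpoly (monicv v ^+ k.+1) (ovseq a k.+1).

Fact ovred_qpoly_is_zmod_morphism k : zmod_morphism (ovred_qpoly k).
Proof.
by move=> a b; rewrite /ovred_qpoly /= in_qpoly_monicv_mod // rmorphB.
Qed.

Fact ovred_qpoly_is_monoid_morphism k : monoid_morphism (ovred_qpoly k).
Proof.
by split=> [|a b]; rewrite /ovred_qpoly /= in_qpoly_monicv_mod ?(rmorph1, rmorphM).
Qed.

HB.instance Definition _ k := GRing.isZmodMorphism.Build O
  {poly %/ monicv v ^+ k.+1} (ovred_qpoly k) (ovred_qpoly_is_zmod_morphism k).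
HB.instance Definition _ k := GRing.isMonoidMorphism.Build O
  {poly %/ monicv v ^+ k.+1} (ovred_qpoly k) (ovred_qpoly_is_monoid_morphism k).

Lemma ovred_qpoly_toOv k a :
  ovred_qpoly k (toOv hv a) = in_qpoly (monicv v ^+ k.+1) a.
Proof. exact: in_qpoly_monicv_mod. Qed.

Lemma in_qpoly_ovseq k l (a : O) : (k < l)%N ->
  in_qpoly (monicv v ^+ k.+1) (ovseq a l) = ovred_qpoly k a.
Proof. by move=> kl; rewrite /ovred_qpoly -(ovseq_mod a kl) in_qpoly_monicv_mod. Qed.

Lemma map_ovred_toOv k (h : {poly {poly F}}) :
  map_poly (ovred_qpoly k) (map_poly (toOv hv) h) =
  map_poly (in_qpoly (monicv v ^+ k.+1)) h.
Proof.
by apply/polyP => i; rewrite !coef_map; apply: ovred_qpoly_toOv.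
Qed.

Hypothesis v_irr : irreducible_poly v.

(** After multiplication by the denominator [d] of [x] the identity holds in F[t]; [d] is prime to
    [v], so it cancels modulo every power of [v]. *)
Lemma ov_rep_clear (a : O) (x : {fraction {poly F}}) (b c : {poly F}) :
  ov_rep a x -> b%:F = c%:F * x -> toOv hv b = toOv hv c * a.
Proof.
move=> [n [d [vd -> ad]]] bcx; have d0 : d != 0.
  by apply: contraNneq vd => ->; rewrite dvdp0.
have bd : b * d = c * n.
  apply: tofrac_inj; rewrite !tofracM bcx -mulrA divfK // tofrac_eq0 //.
apply: ov_ext => k /=; rewrite modMml; apply/eqP.
rewrite -subr_eq0 -modpN -modpD -/(dvdp _ _).
have vkd : coprimep (v ^+ k) d.
  by rewrite coprimep_expl // irreducible_poly_coprime.
rewrite -(Gauss_dvdpl _ vkd) /dvdp mulrBl bd modpD modpN.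
by rewrite -mulrA -[in X in _ - X]modMmr ad modMmr subrr.
Qed.

End Completion.

Lemma size_irr_monic (R : comNzRingType) (h : {poly R}) :
  h \is monic -> ring_irreducible h -> (1 < size h)%N.
Proof.
move=> /monicP h1 [nunit _]; rewrite ltnNge; apply/negP => h0.
move: h1; rewrite (size1_polyC h0) lead_coefC => h1.
by apply: nunit; exists 1; rewrite mulr1 (size1_polyC h0) h1.
Qed.

(** * Linear combinations of the Phi(f_j) *)

Section PhiCombinations.

Variables (R : comNzRingType) (c : R) (r : nat) (fs : 'I_r -> {poly R}).

Lemma Phi_factor i m : m != i -> exists B, Phi c fs m = B * fs i.
Proof.
move=> mi; rewrite /Phi (bigD1 i) 1?eq_sym //=.
by rewrite [fs i * _]mulrC scalerAl mulrAC; eexists.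
Qed.

Definition Phi_comb (y : 'I_r -> R) : {poly R} := \sum_m y m *: Phi c fs m.

(** The Phi(f_m) sum to f' by the product rule, so lowering all weights by [a] subtracts [a] times
    f'. *)
Lemma Phi_combB y a :
  Phi_comb (fun m => y m - a) = Phi_comb y - a *: (c *: \prod_i fs i)^`().
Proof.
rewrite derivZ deriv_prod scaler_sumr scaler_sumr -sumrB; apply: eq_bigr => m _.
by rewrite scalerBl /Phi -scalerAl.
Qed.

Lemma Phi_comb_mod y i : exists B, Phi_comb y = B * fs i + y i *: Phi c fs i.
Proof.
rewrite /Phi_comb (bigD1 i) //= addrC.
suff [B ->] : exists B, \sum_(m < r | m != i) y m *: Phi c fs m = B * fs i.
  by exists B.
elim/big_ind: _ => [||m /Phi_factor[B ->]].
- by exists 0; rewrite mul0r.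
- by move=> _ _ [a ->] [b ->]; exists (a + b); rewrite mulrDl.
by exists (y m *: B); rewrite scalerAl.
Qed.

(** For [m] in [P], the product of the factors outside [P] comes out of Phi(f_m); what remains is
    the product rule on the block. *)
Lemma Phi_comb_sub (P : pred 'I_r) :
  Phi_comb (fun m => (P m)%:R) =
  (c *: \prod_(m | ~~ P m) fs m) * (\prod_(m | P m) fs m)^`().
Proof.
rewrite /Phi_comb (bigID P) /= [X in _ + X]big1 ?addr0 => [|m /negPf->]; last first.
  by rewrite scale0r.
rewrite deriv_prod mulr_sumr; apply: eq_bigr => m Pm.
rewrite Pm scale1r /Phi mulrA; congr (_ * _).
rewrite -scalerAl mulrC (bigID P) /=; congr (_ *: (_ * _)).
  by apply: eq_bigl => j; rewrite andbC.
by apply: eq_bigl => j; case: eqVneq => // ->; rewrite Pm.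
Qed.

Hypothesis fs_monic : forall i, fs i \is monic.

Lemma size_Phi_comb y : (size (Phi_comb y) <= (size (\prod_i fs i)%R).-1)%N.
Proof.
apply: leq_trans (size_sum _ _ _) _; apply/bigmax_leqP => m _.
apply: leq_trans (size_scale_leq _ _) _; rewrite /Phi -scalerAl.
apply: leq_trans (size_scale_leq _ _) _; rewrite [in leqRHS](bigD1 m) //=.
set q := (\prod_(_ | _) _).
have q_monic : q \is monic by apply: monic_prod.
have [->|d0] := eqVneq (fs m)^`() 0; first by rewrite mulr0 size_poly0.
rewrite size_monicM // size_monicM ?monic_neq0 //.
have := lt_size_deriv (monic_neq0 (fs_monic m)).
have : (0 < size q)%N by rewrite size_poly_gt0 monic_neq0.
case: (size q) => // a _; case: (size (fs m)) => // b; rewrite ltnS !addnS addSn /=.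
by rewrite [(b + a)%N]addnC leq_add2l.
Qed.

End PhiCombinations.

(** * Local and global factors *)

Section LocalFactors.

Variables (F : finFieldType) (f : {poly {poly F}}).
Variables (v : {poly F}) (hv : irreducible_poly v).
Hypothesis hvl : ~~ (v %| lead_coef f).
Hypothesis hsqf : sqfree_poly (map_poly (in_qpoly (monicv v)) f).
Variables (r : nat) (fs : 'I_r -> {poly Ov hv.1}).
Hypothesis hfs_monic : forall i, fs i \is monic.
Hypothesis hfs_irr : forall i, ring_irreducible (fs i).

Local Notation toO := (toOv hv.1).
Local Notation c := (toO (lead_coef f)).

Hypothesis hfs : map_poly toO f = c *: \prod_(i < r) fs i.

(** The residue field is finite, so the squarefree results above apply to it. It is convertible with
    the quotient by [monicv v ^+ 1], which lets [rd] be the level 0 reduction. *)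
Let k : finFieldType := {poly %/ monicv v with monicv_irreducible hv.1 hv}.
Let rd : {rmorphism Ov hv.1 -> k} :=
  (ovred_qpoly (hv := hv.1) 0 : {rmorphism Ov hv.1 -> {poly %/ monicv v ^+ 1}}).
Let fb i : {poly k} := map_poly rd (fs i).

Let rd_toOv a : (rd (toO a) == 0) = (v %| a).
Proof.
have := in_qpoly_monicv_eq0 hv.1 a (ltn0Sn 0).
by rewrite -(ovred_qpoly_toOv hv.1 0).
Qed.

Let rd_c : rd c != 0. Proof. by rewrite rd_toOv. Qed.

Let rd_prod (P : pred 'I_r) :
  map_poly rd (\prod_(i | P i) fs i) = \prod_(i | P i) fb i.
Proof. exact: rmorph_prod. Qed.

Let map_rdZ a h : map_poly rd (a *: h) = rd a *: map_poly rd h.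
Proof. by apply/polyP => i; rewrite coefZ !(coef_map rd) coefZ; apply: (rmorphM rd). Qed.

Let sqf : sqfree_poly (rd c *: \prod_i fb i).
Proof.
rewrite -rd_prod -map_rdZ -hfs; have := map_ovred_toOv hv.1 0 f.
by move=> e; move: hsqf; rewrite -e.
Qed.

Let size_fb i : (1 < size (fb i))%N.
Proof.
rewrite size_map_poly_id0 ?(monicP (hfs_monic i)) ?rmorph1 ?oner_neq0 //.
exact: size_irr_monic.
Qed.

Lemma size_prod_fs : size (\prod_i fs i) = size f.
Proof.
have c0 : c != 0 by apply: contraNneq rd_c => ->; rewrite rmorph0.
rewrite -(size_map_poly_id0 c0) hfs -mul_polyC size_Mmonic ?polyC_eq0 //.
  by rewrite size_polyC c0.
by apply: monic_prod => i _.
Qed.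

Lemma f_neq0 : f != 0.
Proof. by apply: contraNneq hvl => ->; rewrite lead_coef0 dvdp0. Qed.

Lemma Phi_comb_constant (n l : nat) (y : 'I_r -> F) (G C : {poly {poly F}})
    (P : pred 'I_r) (i i' : 'I_r) :
  size f = n.+1 -> (0 < n)%N -> (0 < l)%N ->
  ((2 * n - 1) * degt f < l * (size v).-1)%N ->
  f = G * C -> irreducible_poly G ->
  map_poly toO G = toO (lead_coef G) *: \prod_(m | P m) fs m ->
  (forall j, (j < n)%N ->
     size (ovseq (Phi_comb c fs (fun m => toO (y m)%:P))`_j l)%R <= (degt f).+1)%N ->
  P i -> P i' -> y i = y i'.
Proof.
move=> sf n0 l0 hsig fGC G_irr G_fs y_deg Pi Pi'.
pose h z := Phi_comb c fs (fun m => toO (z m)%:P).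
(* [H] lifts [h y] minus [y i] times f' from the reduction modulo v^l to F[t][X]; cutting at [n]
   loses nothing, since [h y] has X-degree below [n]. *)
pose H := \poly_(j < n) ovseq (h y)`_j l - (y i)%:P *: f^`().
have G_factor m : P m -> exists A, map_poly toO G = A * fs m.
  by move=> Pm; rewrite G_fs (bigD1 m) //= mulrC scalerAl; eexists.
have hE : h (fun m => y m - y i) = h y - map_poly toO ((y i)%:P *: f^`()).
  rewrite map_polyZ -deriv_map hfs -Phi_combB; apply: eq_bigr => m _.
  by rewrite polyCB rmorphB.
have redH e : (e < l)%N -> map_poly (in_qpoly (monicv v ^+ e.+1)) H =
    map_poly (ovred_qpoly (hv := hv.1) e) (h (fun m => y m - y i)).
  move=> el; rewrite hE !rmorphB /= map_ovred_toOv; congr (_ - _).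
  apply/polyP => j; rewrite !coef_map coef_poly /=; case: ltnP => [_|nj].
    exact: in_qpoly_ovseq.
  rewrite nth_default ?rmorph0 //; apply: leq_trans nj.
  by have := size_Phi_comb c hfs_monic (fun m => toO (y m)%:P); rewrite size_prod_fs sf.
have [e [Q [ve eHQ]]] : exists e Q, ~~ (v %| e) /\ e *: H = Q * G.
  have [A hA] := G_factor i Pi.
  have [B] := Phi_comb_mod c fs (fun m => toO (y m - y i)%:P) i.
  rewrite subrr polyC0 rmorph0 scale0r addr0 => hB.
  (* Level [l.-1] of [ovred_qpoly] is reduction modulo v^l. *)
  have el : l = l.-1.+1 by rewrite prednK.
  have fsm := monic_map (ovred_qpoly (hv := hv.1) l.-1) (hfs_monic i).
  have G0 : G != 0 by apply: irredp_neq0.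
  have C0 : C != 0 by apply: contraNneq f_neq0 => C0; rewrite fGC C0 mulr0.
  have G_deg j : (size (G`_j)%R <= (degt f).+1)%N.
    apply: leq_trans (max_size_coefXY G j) _; rewrite -sizeY_degt ?f_neq0 //.
    rewrite fGC sizeY_mul //; have : (0 < sizeY C)%N by rewrite lt0n sizeY_eq0.
    by case: (sizeY C) => // d _; rewrite addnS leq_addr.
  have H_deg j : (size (H`_j)%R <= (degt f).+1)%N.
    rewrite coefB coefZ coef_poly coef_deriv mul_polyC -scaler_nat.
    apply: leq_trans (size_polyD _ _) _; rewrite size_polyN geq_max; apply/andP; split.
      by case: ltnP => jn; rewrite ?size_poly0 ?y_deg.
    apply: leq_trans (size_scale_leq _ _) (leq_trans (size_scale_leq _ _) _).
    by rewrite -sizeY_degt ?f_neq0 // max_size_coefXY.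
  have sH : (size H <= n)%N.
    apply: leq_trans (size_polyD _ _) _; rewrite size_polyN geq_max size_poly /=.
    apply: leq_trans (size_scale_leq _ _) _.
    by rewrite -ltnS -sf lt_size_deriv ?f_neq0.
  have sG : (size G <= n.+1)%N.
    rewrite -sf fGC size_mul //; have : (0 < size C)%N by rewrite size_poly_gt0.
    by case: (size C) => // d _; rewrite addnS leq_addr.
  have [||||||->|GH] := @common_factor F v hv.1 l.-1.+1 G H (degt f) (degt f)
    (map_poly (ovred_qpoly (hv := hv.1) l.-1) (fs i))
    (map_poly (ovred_qpoly (hv := hv.1) l.-1) A)
    (map_poly (ovred_qpoly (hv := hv.1) l.-1) B) (ltn0Sn _) fsm _ _ _ G_deg H_deg.
  - rewrite size_map_poly_id0 ?(monicP (hfs_monic i)) ?rmorph1 ?oner_neq0 //.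
    exact: size_irr_monic.
  - by rewrite -(map_ovred_toOv hv.1) hA rmorphM.
  - by rewrite redH -?el // /h hB rmorphM.
  (* The X-degrees of [H] and [G] are at most n - 1 and n; their sum is the constant 2n - 1. *)
  - rewrite -el -mulnDl; apply: leq_ltn_trans hsig; rewrite leq_mul2r.
    by apply/orP; right; move: sH sG n0; move: (size H) (size G) => a b; lia.
  - rewrite -el; apply: leq_ltn_trans hsig; rewrite leq_pmull //.
    by move: n0; lia.
  - exact: G_irr.1.
  - by exists 1, 0; rewrite scaler0 mul0r dvdp1; have := hv.1; case: size => [|[]].
  (* [G] is irreducible, so its nonconstant gcd with [H] is associate to [G]. *)
  have Gdvd : G %| H.
    have gG := G_irr.2 _ _ (dvdp_gcdl G H).
    by rewrite -(eqp_dvdl _ (gG _)) ?dvdp_gcdr //; case: size GH => [|[]].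
  have := Gdvd; rewrite Pdiv.Idomain.dvdp_eq => /eqP eHQ.
  (* The multiplier is the power of the leading coefficient of [G] from pseudo-division. It is prime
     to [v] because that coefficient divides the one of [f]. *)
  exists (lead_coef G ^+ scalp H G), (H %/ G); split=> //.
  rewrite -irreducible_poly_coprime // coprimep_expr // irreducible_poly_coprime //.
  by apply: contra hvl => vG; rewrite fGC lead_coefM dvdp_mulr.
apply/eqP; apply: contraT => yi.
have [A hA] := G_factor i' Pi'.
have : fb i' %| map_poly rd (h (fun m => y m - y i)).
  have -> : map_poly rd (h (fun m => y m - y i)) = map_poly rd (map_poly toO H).
    by rewrite -[LHS](redH 0) // -[LHS](map_ovred_toOv hv.1 0).
  rewrite -(@dvdpZr _ (rd (toO e))) ?rd_toOv // -map_rdZ -map_polyZ eHQ.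
  by rewrite rmorphM /= hA mulrA (rmorphM (map_poly rd)) dvdp_mull.
have [B] := Phi_comb_mod c fs (fun m => toO (y m - y i)%:P) i'.
rewrite -/(h _) => ->; rewrite (rmorphD (map_poly rd)) (rmorphM (map_poly rd)) /=.
(* Modulo [fb i'] only the term of index [i'] survives; its weight is a nonzero constant, hence a
   unit modulo [v]. *)
rewrite dvdp_addr ?dvdp_mull // map_rdZ dvdpZr; last first.
  rewrite rd_toOv gtNdvdp // ?polyC_eq0 ?subr_eq0 1?eq_sym //.
  exact: leq_ltn_trans (size_polyC_leq1 _) hv.1.
rewrite /Phi -scalerAl map_rdZ dvdpZr // (rmorphM (map_poly rd)) /=.
by rewrite -(deriv_map rd) rd_prod (negPf (sqfree_ndvd_deriv sqf (size_fb i'))).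
Qed.

Lemma Phi_comb_block (l j : nat) (G C : {poly {poly F}}) (P : pred 'I_r) :
  (degt f < l * (size v).-1)%N -> f = G * C ->
  map_poly toO G = toO (lead_coef G) *: \prod_(m | P m) fs m ->
  (size (ovseq (Phi_comb c fs (fun m => toO ((P m)%:R)%:P))`_j l)%R <= (degt f).+1)%N.
Proof.
move=> dl fGC G_fs.
have -> : Phi_comb c fs (fun m => toO ((P m)%:R)%:P) = map_poly toO (C * G^`()).
  transitivity (Phi_comb c fs (fun m => (P m)%:R)).
    by apply: eq_bigr => m _; rewrite polyC_natr rmorph_nat.
  have cC : c *: \prod_(m | ~~ P m) fs m = toO (lead_coef G) *: map_poly toO C.
    (* Both sides become the image of [f] after multiplication by the block product, which is monic
       and so cancels. *)
    apply: (@monic_rreg _ (\prod_(m | P m) fs m)); first exact: monic_prod.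
    transitivity (map_poly toO f).
      by rewrite hfs -scalerAl mulrC [in RHS](bigID P).
    by rewrite fGC rmorphM /= G_fs -!scalerAl mulrC.
  rewrite Phi_comb_sub cC rmorphM /= -deriv_map G_fs derivZ.
  by rewrite -scalerAl scalerAr.
rewrite coef_map /=; have CG_deg : (size ((C * G^`())`_j)%R <= (degt f).+1)%N.
  have [->|C0] := eqVneq C 0; first by rewrite mul0r coef0 size_poly0.
  have [->|G'0] := eqVneq G^`() 0; first by rewrite mulr0 coef0 size_poly0.
  have G0 : G != 0 by apply: contraNneq f_neq0 => G0; rewrite fGC G0 mul0r.
  apply: leq_trans (max_size_coefXY _ _) _; rewrite -sizeY_degt ?f_neq0 //.
  rewrite fGC !sizeY_mul // [in leqRHS]addnC -!subn1 leq_sub2r // leq_add2l.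
  apply/bigmax_leqP => i _; rewrite coef_deriv -scaler_nat.
  exact: leq_trans (size_scale_leq _ _) (max_size_coefXY _ _).
by rewrite modp_small // (size_exp_modulus hv.1) ltnS (leq_trans CG_deg).
Qed.

Section GlobalFactors.

Variables (s : nat) (G : 'I_s -> {poly {poly F}}) (wm : 'I_s -> 'I_r -> bool).
Hypothesis G_dvd : forall j, exists C, f = G j * C.
Hypothesis hG : (\prod_j lead_coef (G j)) *: f = lead_coef f *: \prod_j G j.
Hypothesis G_fs : forall j,
  map_poly toO (G j) = toO (lead_coef (G j)) *: \prod_(i < r | wm j i) fs i.

Lemma lead_coef_G j : ~~ (v %| lead_coef (G j)).
Proof.
have [C fGC] := G_dvd j; apply: contra hvl => vG.
by rewrite fGC lead_coefM dvdp_mulr.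
Qed.

(** Reduce [hG] modulo [v] and cancel the leading coefficients, all units there. *)
Let fb_prod : \prod_i fb i = \prod_j \prod_(i | wm j i) fb i.
Proof.
pose a := \prod_j toO (lead_coef (G j)).
have rda : rd a != 0.
  rewrite (rmorph_prod rd); apply/prodf_neq0 => j _.
  by rewrite rd_toOv lead_coef_G.
have := congr1 (map_poly toO) hG.
rewrite !map_polyZ rmorph_prod (rmorph_prod (map_poly toO)) hfs.
under [X in _ = _ *: X -> _]eq_bigr => j _ do rewrite /= G_fs.
rewrite scaler_prod -/a => /(congr1 (map_poly rd)).
rewrite !map_rdZ rd_prod (rmorph_prod (map_poly rd)).
under [X in _ = _ *: (_ *: X) -> _]eq_bigr => j _ do rewrite /= rd_prod.
rewrite scalerA mulrC -scalerA => /(scalerI rd_c) /(scalerI rda).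
exact.
Qed.

(** Outside all blocks, [fb i] would be coprime to the full product, of which it is a nonconstant
    factor. *)
Lemma wm_cover i : exists j, wm j i.
Proof.
have [/existsP[j wji]|/existsPn nw] := boolP [exists j, wm j i]; first by exists j.
suff: coprimep (fb i) (\prod_m fb m).
  rewrite (bigD1 i) //= coprimepMr coprimepp => /andP[/eqP si _].
  by have := size_fb i; rewrite si.
rewrite fb_prod; elim/big_rec: _ => [|j q _ IH]; first exact: coprimep1.
by rewrite coprimepMr IH andbT (sqfree_coprime_prod sqf).
Qed.

(** An index in two blocks would make the square of [fb i] divide a squarefree polynomial. *)
Lemma wm_disjoint i j j' : wm j i -> wm j' i -> j = j'.
Proof.
move=> wji wj'i; apply/eqP; apply: contraT => jj'.
have := size_fb i; rewrite (sqfree_size sqf) //.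
rewrite dvdpZr // fb_prod (bigD1 j) // (bigD1 j') 1?eq_sym //= mulrA dvdp_mulr //.
rewrite expr2 dvdp_mul //.
  by rewrite (bigD1 i) //= dvdp_mulr.
by rewrite (bigD1 i wj'i) dvdp_mulr.
Qed.

End GlobalFactors.

End LocalFactors.

(** * From the kernels to degree bounds, and the span of the blocks *)

Lemma Amat_comb (F : fieldType) (v : {poly F}) (hv : (1 < size v)%N) (c : Ov hv)
    (r : nat) (fs : 'I_r -> {poly Ov hv}) (l m sigma i : nat) (y : 'I_r -> F) k :
  \sum_j Amat c fs l m sigma i k j * y j =
  (ovseq (Phi_comb c fs (fun j => toOv hv (y j)%:P))`_i l)`_(m + k).
Proof.
rewrite coef_sum ovseq_sum coef_sum; apply: eq_bigr => j _.
by rewrite coefZ ovseqZ coefZ !mxE mulrC.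
Qed.

Lemma phim_eq0 (F : fieldType) (m sigma : nat) (c : {poly F}) :
  (size c <= sigma)%N ->
  (forall k : 'I_(sigma - m), c`_(m + k) = 0) <-> (size c <= m)%N.
Proof.
move=> c_sigma; split=> [c0|cm k]; last first.
  by rewrite nth_default // (leq_trans cm) // leq_addr.
apply/leq_sizeP => j mj; have [js|sj] := ltnP j sigma.
  have jk : (j - m < sigma - m)%N by rewrite ltn_sub2r // (leq_ltn_trans mj).
  by have := c0 (Ordinal jk); rewrite /= subnKC.
by rewrite nth_default // (leq_trans c_sigma).
Qed.

Lemma Wmx_submx (p s r : nat) (wm : 'I_s -> 'I_r -> bool) (x : 'cV['F_p]_r) :
  (forall i, exists j, wm j i) ->
  (forall i j j', wm j i -> wm j' i -> j = j') ->
  (forall i i' j, wm j i -> wm j i' -> x i 0 = x i' 0) ->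
  (x^T <= Wmx p wm)%MS.
Proof.
move=> cover disj const; apply/submxP.
(* Each block is weighted by the common value of [x] on it; an empty block has a zero row, and gets
   weight 0. *)
exists (\row_j (if [pick i | wm j i] is Some i then x i 0 else 0)).
apply/rowP => i; have [j wji] := cover i; rewrite !mxE (bigD1 j) //= big1 => [|j' jj'].
  rewrite !mxE wji mulr1 addr0; case: pickP => [i' wji'|/(_ i)]; last by rewrite wji.
  exact: const wji wji'.
rewrite !mxE; case: (boolP (wm j' i)) jj' => [/disj/(_ wji)->|_ _].
  by rewrite eqxx.
by rewrite mulr0.
Qed.

Theorem theorem5p2
  (* F = F_q, q = p^w; gam is an F_p-basis of F_q and psi the coordinate map *)
  (F : finFieldType) (p w : nat) (hp : prime p) (hchar : p \in [pchar F])
  (gam : 'I_w -> F) (psi : F -> 'cV['F_p]_w)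
  (hpsi1 : forall c : F, gam_comb gam (psi c) = c)
  (hpsi2 : forall x : 'cV['F_p]_w, psi (gam_comb gam x) = x)
  (* f in F_q[t][X], separable, of X-degree n >= 2 *)
  (f : {poly {poly F}}) (n : nat) (hn : size f = n.+1) (hn2 : (2 <= n)%N)
  (hsep : separable_poly (map_poly (fun a : {poly F} => a%:F) f))
  (* v irreducible, v does not divide l_f, f mod v squarefree in k[X] *)
  (v : {poly F}) (hv : irreducible_poly v) (hvl : ~~ (v %| lead_coef f))
  (hsqf : sqfree_poly (map_poly (in_qpoly (monicv v)) f))
  (* factorisation over O_v *)
  (r : nat) (fs : 'I_r -> {poly Ov hv.1})
  (hfs_monic : forall i, fs i \is monic)
  (hfs_irr : forall i, ring_irreducible (fs i))
  (hfs : map_poly (toOv hv.1) f = toOv hv.1 (lead_coef f) *: \prod_(i < r) fs i)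
  (* factorisation over K = F_q(t) *)
  (s : nat) (g : 'I_s -> {poly {fraction {poly F}}})
  (hg_monic : forall j, g j \is monic)
  (hg_irr : forall j, irreducible_poly (g j))
  (hg : map_poly (fun a : {poly F} => a%:F) f = (lead_coef f)%:F *: \prod_(j < s) g j)
  (* g_j = prod_i f_i^{w_{j,i}} *)
  (wm : 'I_s -> 'I_r -> bool)
  (hw : forall (j : 'I_s) (k : nat),
      ov_rep ((\prod_(i < r | wm j i) fs i)`_k) ((g j)`_k))
  (* precision *)
  (l : nat) (hl : (1 <= l)%N)
  (hsig : ((2 * n - 1) * degt f < l * (size v).-1)%N) :
  let sigma := (l * (size v).-1)%N in
  let m := (degt f).+1 in
  let A := fun i : 'I_n =>
    Amat (toOv hv.1 (lead_coef f)) fs l m sigma i in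
  forall x : 'cV['F_p]_r,
    (forall i : 'I_n, Atil psi (A i) *m x = 0) <-> (x^T <= Wmx p wm)%MS.
Proof.
move=> sigma m A x.
have f0 := f_neq0 hvl.
have {}hg : map_poly (@FracField.tofrac _) f = (lead_coef f)%:F *: \prod_(j < s) g j.
  exact: hg.
have /choice[G GP] j : exists G, (exists C, f = G * C) /\
    map_poly (@FracField.tofrac _) G = (lead_coef G)%:F *: g j.
  have [|G [C [fGC eG]]] := integral_factor f0 (hg_monic j)
    (h := (lead_coef f)%:F *: \prod_(j' < s | j' != j) g j').
    by rewrite hg (bigD1 j) //= scalerAr.
  by exists G; split=> //; exists C.
have G0 j : G j != 0.
  by have [[C fGC] _] := GP j; apply: contraNneq f0 => Gj0; rewrite fGC Gj0 mul0r.
have G_irr j : irreducible_poly (G j).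
  exact: integral_irreducible (hg_irr j) (GP j).2 (G0 j).
have G_fs j : map_poly (toOv hv.1) (G j) =
    toOv hv.1 (lead_coef (G j)) *: \prod_(i < r | wm j i) fs i.
  apply/polyP => k; rewrite coef_map coefZ; apply: (ov_rep_clear hv (hw j k)).
  by have /(congr1 (fun u : {poly _} => u`_k)) := (GP j).2; rewrite coef_map coefZ.
have hG : (\prod_j lead_coef (G j)) *: f = lead_coef f *: \prod_j G j.
  apply: map_tofrac_inj.
  rewrite !map_polyZ rmorph_prod (rmorph_prod (map_poly _)) /= hg.
  under [X in _ = _ *: X]eq_bigr => j _ do rewrite (GP j).2.
  by rewrite scaler_prod !scalerA mulrC.
have G_dvd j : exists C, f = G j * C by case: (GP j).
have dl : (degt f < l * (size v).-1)%N.
  apply: leq_ltn_trans hsig; rewrite leq_pmull // subn_gt0.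
  by rewrite (leq_trans hn2) // leq_pmull.
(* Membership in a kernel says that the coefficients of t^m, ..., t^(sigma - 1) vanish; the
   truncation has no others from t^m on, so this is a bound on its degree. *)
have kerP (z : 'cV['F_p]_r) i : Atil psi (A i) *m z = 0 <->
    (size (ovseq (Phi_comb (toOv hv.1 (lead_coef f)) fs
      (fun m => toOv hv.1 (Fp_emb F (z m 0))%:P))`_i l)%R <= m)%N.
  rewrite -(phim_eq0 _ (size_ovseq _ _)) (Atil_mulmx_eq0 hchar hpsi1 hpsi2).
  by split=> h k; have := h k; rewrite Amat_comb.
split=> [Ax0 | /submxP[u xu]].
  apply: Wmx_submx => [i|i j j'|i i' j wji wji'].
  - exact: (wm_cover hvl hsqf hfs_monic hfs_irr hfs G_dvd hG G_fs).
  - exact: (wm_disjoint hvl hsqf hfs_monic hfs_irr hfs G_dvd hG G_fs).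
  have [C fGC] := G_dvd j; apply: (Fp_emb_inj hchar).
  apply: (Phi_comb_constant hvl hsqf hfs_monic hfs_irr hfs hn (ltnW hn2) hl hsig
    fGC (G_irr j) (G_fs j) (y := fun i => Fp_emb F (x i 0))) wji wji' => k kn.
  exact/(kerP x (Ordinal kn)).
move=> i; rewrite -[x]trmxK xu trmx_mul mulmxA.
(* By linearity it is enough to treat the generators of W, one block at a time. *)
suff -> : Atil psi (A i) *m (Wmx p wm)^T = 0 by rewrite mul0mx.
apply/matrixP => t j.
suff /colP/(_ t) : Atil psi (A i) *m col j (Wmx p wm)^T = 0.
  by rewrite !mxE => e; rewrite -[RHS]e; apply: eq_bigr => k _; rewrite !mxE.
apply/kerP.
have [C fGC] := G_dvd j.
rewrite (_ : Phi_comb _ _ _ = Phi_comb (toOv hv.1 (lead_coef f)) fs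
  (fun k => toOv hv.1 ((wm j k)%:R)%:P)).
  exact (Phi_comb_block hvl hfs_monic hfs i dl fGC (G_fs j)).
by apply: eq_bigr => k _; rewrite !mxE Fp_emb_bool.
Qed.
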